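(* Suppose the model is a Markov model with common known initial distribution $q^{(0)}$, the data are generated under $\theta_0$, and the resulting chain is $\alpha$-mixing with $\sum_{k\ge1}\alpha_k^{\delta/(2+\delta)}<\infty$ for some $\delta>0$. Assume there are functions $M^{(1)}_k$ with $\sup_{x,y}|M^{(1)}_k(y,x)|<B$ and $f^{(1)}_k:\Theta\times\Theta\to\mathbb{R}$, $k=1,\dots,m$, such that $|\log p_{\theta_1}(y|x)-\log p_{\theta_2}(y|x)|\le\sum_{k=1}^m M^{(1)}_k(y,x)|f^{(1)}_k(\theta_2,\theta_1)|$ for all $\theta_1,\theta_2\in\Theta$ and states $x,y$; that there are $C>0$ and $\rho_n\in\mathcal{F}$ with $\int|f^{(1)}_k(\theta,\theta_0)|^{2+\delta}\rho_n(d\theta)\le C/n$ and $\int|f^{(1)}_k(\theta,\theta_0)|\rho_n(d\theta)\le C/\sqrt n$ for all $k,n$; and that $\mathcal{K}(\rho_n,\pi)\le C\sqrt n$. Then there exist $\epsilon_n=O\big(\max(n^{-1/2},n^{\delta/2}/n)\big)$ such that conditions (C1)–(C3) hold for $\rho_n$ and $\epsilon_n$.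
   Context: Markov model with known initial distribution: for each $\theta\in\Theta\subseteq\mathbb{R}^d$, $p_\theta(y|x)$ is a transition density (w.r.t. Lebesgue or counting measure), and $P^{(n)}_\theta$ is the law of $(X_0,\dots,X_n)$ with density $q^{(0)}(x_0)\prod_{i=1}^n p_\theta(x_i|x_{i-1})$, with the same initial density $q^{(0)}$ for all $\theta$. $\mathrm{E},\mathrm{Var}$ are under $P^{(n)}_{\theta_0}$. $r_n(\theta,\theta_0):=\log(p^{(n)}_{\theta_0}(X^n)/p^{(n)}_\theta(X^n))$; $\mathcal{K}$ is KL divergence; $\pi$ is a prior and $\mathcal{F}$ a family of distributions on $\Theta$. Conditions: (C1) $\int\mathcal{K}(P^{(n)}_{\theta_0},P^{(n)}_\theta)\rho_n(d\theta)\le n\epsilon_n$; (C2) $\int\mathrm{Var}(r_n(\theta,\theta_0))\rho_n(d\theta)\le n\epsilon_n$; (C3) $\mathcal{K}(\rho_n,\pi)\le n\epsilon_n$. $\alpha$-mixing coefficients: $\alpha_k:=\sup_{t\ge0}\sup\{|P(A\cap B)-P(A)P(B)|:A\in\sigma(X_0,\dots,X_t),B\in\sigma(X_s:s\ge t+k)\}$ under $\theta_0$. $\epsilon_n=O(a_n)$ means $\epsilon_n\le Ka_n$ for some constant $K$ and all $n$. *)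

(* Defs.v *)
From HB Require Import structures.
From mathcomp Require Import all_boot all_order all_algebra.
From mathcomp Require Import all_classical all_reals all_analysis.
Set Implicit Arguments. Unset Strict Implicit. Unset Printing Implicit Defensive.
Import Order.TTheory GRing.Theory Num.Theory.
Local Open Scope classical_set_scope.
Local Open Scope ring_scope.

Definition is_prob_density {R : realType} {dX} {X : measurableType dX}
  (mu : {measure set X -> \bar R}) (q : X -> R) : Prop :=
  [/\ measurable_fun setT q, (forall x, 0 <= q x) & (\int[mu]_x (q x)%:E = 1)%E].

Definition is_transition_density {R : realType} {dX} {X : measurableType dX}
  (mu : {measure set X -> \bar R}) (p : X -> X -> R) : Prop :=
  [/\ measurable_fun setT (fun yx : X * X => p yx.1 yx.2),
      (forall y x, 0 <= p y x) &
      (forall x, \int[mu]_y (p y x)%:E = 1)%E].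

Fixpoint pathint {R : realType} {dX} {X : measurableType dX}
  (mu : {measure set X -> \bar R}) (p : X -> X -> R) (As : seq (set X)) (x : X)
  : \bar R :=
  match As with
  | [::] => 1%E
  | A :: As' => (\int[mu]_(y in A) ((p y x)%:E * pathint mu p As' y))%E
  end.

(* Under P, (Xs n)_n is a Markov chain: for every n, the law of (X_0,...,X_n)
   has density q(x_0) prod_{i=1}^n p(x_i|x_{i-1}) w.r.t. mu^{n+1}
   (stated on measurable rectangles A_0 x ... x A_n, which determine the law). *)
Definition markov_chain_law {R : realType} {dX} {X : measurableType dX}
  {dO} {Omega : measurableType dO}
  (mu : {measure set X -> \bar R}) (q : X -> R) (p : X -> X -> R)
  (P : probability Omega R) (Xs : nat -> Omega -> X) : Prop :=
  (forall n, measurable_fun setT (Xs n)) /\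
  forall (A0 : set X) (As : seq (set X)), measurable A0 ->
    (forall i, (i < size As)%N -> measurable (nth set0 As i)) ->
    P [set w | A0 (Xs 0%N w) /\
               forall i, (i < size As)%N -> nth set0 As i (Xs i.+1 w)]
    = (\int[mu]_(x in A0) ((q x)%:E * pathint mu p As x))%E.

Definition sigma_gen {dO} {Omega : measurableType dO} {dX} {X : measurableType dX}
  (Xs : nat -> Omega -> X) (I : set nat) : set (set Omega) :=
  <<s \bigcup_(i in I) [set Xs i @^-1` A | A in (@measurable _ X)] >>.

Definition sigma_past {dO} {Omega : measurableType dO} {dX} {X : measurableType dX}
  (Xs : nat -> Omega -> X) (t : nat) := sigma_gen Xs [set i | (i <= t)%N].

Definition sigma_future {dO} {Omega : measurableType dO} {dX} {X : measurableType dX}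
  (Xs : nat -> Omega -> X) (u : nat) := sigma_gen Xs [set i | (u <= i)%N].

Definition alpha_mix {R : realType} {dO} {Omega : measurableType dO}
  {dX} {X : measurableType dX}
  (P : probability Omega R) (Xs : nat -> Omega -> X) (k : nat) : R :=
  sup [set r : R | exists t A B, [/\ sigma_past Xs t A,
        sigma_future Xs (t + k)%N B &
        r = `|fine (P (A `&` B)) - fine (P A) * fine (P B)| ] ].

Definition path_density {R : realType} {dO} {Omega : measurableType dO}
  {dX} {X : measurableType dX}
  (q : X -> R) (p : X -> X -> R) (Xs : nat -> Omega -> X) (n : nat) (w : Omega) : R :=
  q (Xs 0%N w) * \prod_(i < n) p (Xs i.+1 w) (Xs i w).

Definition r_n {R : realType} {dO} {Omega : measurableType dO}
  {dX} {X : measurableType dX} {dT} {Theta : measurableType dT}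
  (q : X -> R) (p : Theta -> X -> X -> R) (Xs : nat -> Omega -> X) (n : nat)
  (theta theta0 : Theta) (w : Omega) : R :=
  ln (path_density q (p theta0) Xs n w / path_density q (p theta) Xs n w).

(* K(P^{(n)}_theta0, P^{(n)}_theta) = E_{theta0}[ log(p^{(n)}_theta0 / p^{(n)}_theta) ]
   (both laws have densities w.r.t. mu^{n+1}, realized on the path of the chain) *)
Definition KL_path {R : realType} {dO} {Omega : measurableType dO}
  {dX} {X : measurableType dX} {dT} {Theta : measurableType dT}
  (P : probability Omega R) (q : X -> R) (p : Theta -> X -> X -> R)
  (Xs : nat -> Omega -> X) (n : nat) (theta0 theta : Theta) : \bar R :=
  'E_P[r_n q p Xs n theta theta0].

Definition is_density_wrt {R : realType} {dT} {Theta : measurableType dT}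
  (pi rho : probability Theta R) (g : Theta -> R) : Prop :=
  [/\ measurable_fun setT g, (forall t, 0 <= g t) &
      (forall A, measurable A -> rho A = \int[pi]_(t in A) (g t)%:E)%E].

Definition KL {R : realType} {dT} {Theta : measurableType dT}
  (rho pi : probability Theta R) : \bar R :=
  match pselect (exists g, is_density_wrt pi rho g) with
  | left h => (\int[rho]_t (ln (projT1 (cid h) t))%:E)%E
  | right _ => +oo%E
  end.

(* |log p_{th1}(y|x) - log p_{th2}(y|x)| <= sum_k M_k(y,x) |f_k(th2,th1)|,
   with log 0 = -oo: either both densities vanish (|-oo - (-oo)| := 0)
   or both are positive and the bound holds for the real logarithms. *)
Definition log_lipschitz {R : realType} {dX} {X : measurableType dX}
  {dT} {Theta : measurableType dT} (m : nat)
  (p : Theta -> X -> X -> R) (M : 'I_m -> X -> X -> R) (f : 'I_m -> Theta -> Theta -> R)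
  : Prop :=
  forall th1 th2 x y,
    (p th1 y x = 0 /\ p th2 y x = 0) \/
    [/\ 0 < p th1 y x, 0 < p th2 y x &
        `|ln (p th1 y x) - ln (p th2 y x)| <= \sum_(k < m) M k y x * `|f k th2 th1| ].

(* Main.v *)
Require Import Defs.
From HB Require Import structures.
From mathcomp Require Import all_boot all_order all_algebra.
From mathcomp Require Import all_classical all_reals all_analysis.
From mathcomp Require Import ring lra measurable_realfun.
Import Order.TTheory GRing.Theory Num.Theory.
Local Open Scope classical_set_scope.
Local Open Scope ring_scope.
Set Implicit Arguments.
Unset Strict Implicit.

(** Almost surely the path density is positive, and then the log-likelihood ratio is the sum of the
    one-step terms [log p_theta0 - log p_theta], each bounded by
    [c := |B| * \sum_k |f k theta theta0|].
    Hence the Kullback-Leibler divergence is at most [n * c].  For the variance, terms at lag [k]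
    have covariance at most [4 * c^2 * alpha_(k-1)] because they are bounded, and
    [alpha_k <= alpha_k^(delta/(2+delta))] is summable, so the variance is [O(n * c^2)].
    Finally [|f|^2 <= |f| + |f|^(2+delta)] gives [\int c^2 = O(1/sqrt n)], so that
    [eps n := K / sqrt n] works in all three conditions. *)

(** Mixing speaks of events, the variance of functions. The bridge is that a bounded function is, up
    to scaling and a small error, an average of indicators of its level sets, so its covariances are
    averages of the quantities whose supremum is [alpha_mix]. As the log-ratios are bounded for each
    fixed parameter, mixing coefficients enter to the first power; moments of order [2 + delta]
    serve only afterwards, for integrating the square of the bound over the parameter.

    The second obstacle is vanishing densities. Since [ln 0 = 0], the log-likelihood ratio is not
    additive along paths of density zero, so these paths must form a null event. The law of the
    chain is given on rectangles only, and the zero set of [p] is not a rectangle; hence the joint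
    law of two successive states has to be identified as a measure on the product. *)

Section BoundedCovariance.
Context {R : realType} {d : measure_display} {T : measurableType d}.
Variable P : probability T R.
Implicit Types (U V W : T -> R) (c : R).

(** * Bounded random variables and their covariances *)

Definition bounded_mfun U := measurable_fun setT U /\ exists c, forall x, `|U x| <= c.

Lemma bounded_mfun_integrable U : bounded_mfun U -> P.-integrable setT (EFin \o U).
Proof.
move=> [mU [c Uc]]; apply: measurable_bounded_integrable => //.
  by rewrite (le_lt_trans (probability_le1 P measurableT)) ?ltry.
exists c; split; first exact: num_real.
by move=> M cM x _; exact: le_trans (Uc x) (ltW cM).
Qed.

Lemma bounded_mfun_cst c : bounded_mfun (fun=> c).
Proof. by split; [exact: measurable_cst | exists `|c|]. Qed.

Lemma bounded_mfunD U V :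
  bounded_mfun U -> bounded_mfun V -> bounded_mfun (fun x => U x + V x).
Proof.
move=> [mU [a Ua]] [mV [b Vb]]; split; first exact: measurable_funD.
by exists (a + b) => x; rewrite (le_trans (ler_normD _ _))// lerD.
Qed.

Lemma bounded_mfunM U V :
  bounded_mfun U -> bounded_mfun V -> bounded_mfun (fun x => U x * V x).
Proof.
move=> [mU [a Ua]] [mV [b Vb]]; split; first exact: measurable_funM.
by exists (a * b) => x; rewrite normrM ler_pM.
Qed.

Lemma bounded_mfun_sum (n : nat) (F : nat -> T -> R) :
  (forall i, (i < n)%N -> bounded_mfun (F i)) -> bounded_mfun (fun x => \sum_(i < n) F i x).
Proof.
elim: n => [|n IH] hF.
  under eq_fun do rewrite big_ord0.
  exact: bounded_mfun_cst.
under eq_fun do rewrite big_ord_recr.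
by apply: bounded_mfunD; [apply: IH => i ni; apply: hF; exact: ltnW|exact: hF].
Qed.

Lemma bounded_mfun_indic (A : set T) : measurable A -> bounded_mfun (\1_A : T -> R).
Proof.
move=> mA; split; first exact: measurable_indic.
by exists 1 => x; rewrite indicE; case: (x \in A); rewrite ?normr1 ?normr0.
Qed.

(** A real-valued form of the covariance, so that bilinearity and estimates are plain real algebra;
    [covariance_bounded_mfun] returns to [covariance P]. *)
Definition rcov U V := \int[P]_x (U x * V x) - \int[P]_x U x * \int[P]_x V x.

Lemma Rintegral_cstT c : \int[P]_x c = c.
Proof. by rewrite /Rintegral integral_cst//= probability_setT mule1. Qed.

Lemma rcovC U V : rcov U V = rcov V U.
Proof.
by rewrite /rcov mulrC; congr (_ - _); apply: eq_Rintegral => x _; rewrite mulrC.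
Qed.

Lemma rcovDl U V W : bounded_mfun U -> bounded_mfun V -> bounded_mfun W ->
  rcov (fun x => U x + V x) W = rcov U W + rcov V W.
Proof.
move=> bU bV bW; rewrite /rcov.
under eq_Rintegral do rewrite mulrDl.
rewrite !RintegralD//; try exact/bounded_mfun_integrable.
- by rewrite mulrDl opprD addrACA.
- exact/bounded_mfun_integrable/bounded_mfunM.
- exact/bounded_mfun_integrable/bounded_mfunM.
Qed.

Lemma rcovDr U V W : bounded_mfun U -> bounded_mfun V -> bounded_mfun W ->
  rcov W (fun x => U x + V x) = rcov W U + rcov W V.
Proof. by move=> *; rewrite rcovC rcovDl// ![rcov _ W]rcovC. Qed.

Lemma rcov_cstl c U : bounded_mfun U -> rcov (fun=> c) U = 0.
Proof.
move=> bU; rewrite /rcov RintegralZl//; last exact: bounded_mfun_integrable.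
by rewrite Rintegral_cstT subrr.
Qed.

Lemma rcovZl c U V : bounded_mfun U -> bounded_mfun V ->
  rcov (fun x => c * U x) V = c * rcov U V.
Proof.
move=> bU bV; rewrite /rcov.
under eq_Rintegral do rewrite -mulrA.
rewrite !RintegralZl//; [by rewrite mulrBr mulrA|exact: bounded_mfun_integrable|].
exact/bounded_mfun_integrable/bounded_mfunM.
Qed.

Lemma rcovZr c U V : bounded_mfun U -> bounded_mfun V ->
  rcov V (fun x => c * U x) = c * rcov V U.
Proof. by move=> *; rewrite rcovC rcovZl// rcovC. Qed.

Lemma rcov_suml (n : nat) (F : nat -> T -> R) V :
  (forall i, bounded_mfun (F i)) -> bounded_mfun V ->
  rcov (fun x => \sum_(i < n) F i x) V = \sum_(i < n) rcov (F i) V.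
Proof.
move=> bF bV; elim: n => [|n IH].
  rewrite big_ord0 (_ : (fun x => _) = fun=> 0) ?rcov_cstl//.
  by apply/funext => x; rewrite big_ord0.
rewrite big_ord_recr /= -IH -rcovDl//; last by apply: (@bounded_mfun_sum n F) => i _; exact: bF.
by congr rcov; apply/funext => x; rewrite big_ord_recr.
Qed.

Lemma rcov_sumr (n : nat) (F : nat -> T -> R) V :
  (forall i, bounded_mfun (F i)) -> bounded_mfun V ->
  rcov V (fun x => \sum_(i < n) F i x) = \sum_(i < n) rcov V (F i).
Proof.
by move=> *; rewrite rcovC rcov_suml//; apply: eq_bigr => i _; rewrite rcovC.
Qed.

Lemma rcov_indic (A B : set T) : measurable A -> measurable B ->
  rcov \1_A \1_B = fine (P (A `&` B)) - fine (P A) * fine (P B).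
Proof.
move=> mA mB; rewrite /rcov.
have Ei (C : set T) : measurable C -> \int[P]_x (\1_C x : R) = fine (P C).
  by move=> mC; rewrite /Rintegral integral_indic// setIT.
rewrite (Ei A)// (Ei B)// -(Ei (A `&` B)); last exact: measurableI.
by congr (_ - _); apply: eq_Rintegral => x _; rewrite indicI.
Qed.

Lemma norm_Rintegral_le U c : measurable_fun setT U ->
  (forall x, `|U x| <= c) -> `|\int[P]_x U x| <= c.
Proof.
move=> mU Uc.
have bU : bounded_mfun U by split => //; exists c.
apply: (le_trans (le_normr_Rintegral _ _)) => //; first exact: bounded_mfun_integrable.
have -> : c = \int[P]_x c by rewrite Rintegral_cstT.
apply: le_Rintegral => //.
- apply: bounded_mfun_integrable; split; first exact: measurableT_comp.
  by exists c => x; rewrite normr_id.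
- exact/bounded_mfun_integrable/bounded_mfun_cst.
Qed.

Lemma norm_rcov_le U V a b : measurable_fun setT U -> measurable_fun setT V ->
  (forall x, `|U x| <= a) -> (forall x, `|V x| <= b) -> `|rcov U V| <= 2 * (a * b).
Proof.
move=> mU mV Ua Vb; rewrite /rcov mulr_natl mulr2n.
apply: (le_trans (ler_normB _ _)); apply: lerD.
  apply: norm_Rintegral_le; first exact: measurable_funM.
  by move=> x; rewrite normrM ler_pM.
by rewrite normrM ler_pM// norm_Rintegral_le.
Qed.

(** The sum counts the integers between 1 and [n] that are at most [t]: it is the integer part of
    [t], cut off at [n]. The second alternative is the cut-off. *)
Lemma staircase_sum (n : nat) (t : R) : 0 <= t ->
  \sum_(k < n) (k.+1%:R <= t)%R%:R <= t /\
  (t <= \sum_(k < n) (k.+1%:R <= t)%R%:R + 1 \/ \sum_(k < n) (k.+1%:R <= t)%R%:R = n%:R :> R).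
Proof.
move=> t0; elim: n => [|n [le IH]]; first by rewrite big_ord0; split => //; right.
rewrite big_ord_recr /=; set s := \sum_(_ < _) _ in le IH *.
have [nt|tn] := leP n.+1%:R t; last first.
  rewrite addr0; split => //; left.
  by case: IH => // ->; rewrite -natr1 in tn; exact: ltW.
case: IH => [ts|->]; last by rewrite natr1; split => //; right.
have sn : s <= n%:R.
  rewrite /s -[n in n%:R]card_ord -sum1_card natr_sum; apply: ler_sum => i _.
  by rewrite ler_nat leq_b1.
have e : s = n%:R.
  apply/eqP; rewrite eq_le sn /= -(lerD2r 1) (le_trans _ ts)//.
  by rewrite natr1.
by rewrite e natr1; split => //; right.
Qed.

(* Replacing [U] and [V] by staircase functions with [n] steps reduces the bound to indicators of
   level sets, at the cost of an error [O(1/n)]. *)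
Lemma rcov_le_levels01 U V a : measurable_fun setT U -> measurable_fun setT V ->
  (forall x, 0 <= U x <= 1) -> (forall x, 0 <= V x <= 1) ->
  (forall s t, `|fine (P ([set x | s <= U x] `&` [set x | t <= V x])) -
     fine (P [set x | s <= U x]) * fine (P [set x | t <= V x])| <= a) ->
  `|rcov U V| <= a.
Proof.
move=> mU mV U01 V01 ha.
have bU : bounded_mfun U.
  by split => //; exists 1 => x; have /andP[? ?] := U01 x; rewrite ger0_norm.
have bV : bounded_mfun V.
  by split => //; exists 1 => x; have /andP[? ?] := V01 x; rewrite ger0_norm.
have mlev W s : measurable_fun setT W -> measurable [set x | s <= W x].
  move=> mW; rewrite (_ : [set _ | _] = setT `&` W @^-1` `[s, +oo[).
    exact: mW.
  by rewrite setTI; apply/seteqP; split => x /=; rewrite in_itv/= andbT.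
(* After multiplication by [n ^ 2] the error consists of two covariances of size at most [2 * n]
   each, whence [4 / n]. *)
suff key (n : nat) : (0 < n)%N -> `|rcov U V| <= a + 4 / n%:R.
  apply/ler_addgt0Pr => e e0.
  pose n := (Num.truncn (4 / e)).+1.
  apply: (le_trans (key n isT)); rewrite lerD2l ler_pdivrMr ?ltr0n//.
  rewrite mulrC -ler_pdivrMr// ltW//.
  exact: truncnS_gt.
move=> n0; have nR0 : 0 < n%:R :> R by rewrite ltr0n.
pose A W k := [set x | k.+1%:R / n%:R <= W x].
pose S W x : R := \sum_(k < n) \1_(A W k) x.
pose D W x : R := n%:R * W x - S W x.
have SE W x : S W x = \sum_(k < n) (k.+1%:R <= n%:R * W x)%R%:R.
  apply: eq_bigr => k _; rewrite indicE; congr (_ %:R).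
  have -> : (k.+1%:R <= n%:R * W x)%R = (k.+1%:R / n%:R <= W x).
    by rewrite ler_pdivrMr// mulrC.
  by apply: congr1; apply/idP/idP; rewrite inE.
have bS W : measurable_fun setT W -> bounded_mfun (S W).
  move=> mW; apply: (@bounded_mfun_sum n (fun k => \1_(A W k))) => i _.
  exact/bounded_mfun_indic/mlev.
have bD W : bounded_mfun W -> bounded_mfun (D W).
  move=> bW; rewrite /D.
  rewrite (_ : (fun x => _) = fun x => n%:R * W x + (-1) * S W x); last first.
    by apply/funext => x; rewrite mulN1r.
  have [mW _] := bW.
  apply: bounded_mfunD; apply: bounded_mfunM => //; try exact: bounded_mfun_cst.
  exact: bS.
have D01 W x : 0 <= W x <= 1 -> `|D W x| <= 1.
  move=> /andP[W0 W1]; have [le hl] := @staircase_sum n (n%:R * W x) (mulr_ge0 (ler0n _ _) W0).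
  rewrite -SE in le hl; rewrite /D ger0_norm ?subr_ge0// lerBlDl addrC.
  case: hl => [|->]; first by rewrite addrC.
  by rewrite (le_trans (_ : _ <= n%:R * 1)) ?ler_wpM2l// mulr1 lerDr.
have Sn W x : `|S W x| <= n%:R.
  rewrite SE ger0_norm ?sumr_ge0//.
  rewrite -[n in X in _ <= X]card_ord -sum1_card natr_sum; apply: ler_sum => i _.
  by rewrite ler_nat leq_b1.
have nW W x : 0 <= W x <= 1 -> `|n%:R * W x| <= n%:R.
  move=> /andP[W0 W1]; rewrite normrM !ger0_norm//.
  by rewrite -[X in _ <= X]mulr1 ler_wpM2l.
(* [n * U] is split into staircase and remainder, but [n * V] only against the staircase of [U].
   Each of the two error terms then pairs a remainder bounded by 1 with a function bounded by
   [n]. *)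
have e : n%:R * (n%:R * rcov U V) =
    rcov (S U) (S V) + rcov (S U) (D V) + rcov (D U) (fun x => n%:R * V x).
  have bnV : bounded_mfun (fun x => n%:R * V x).
    by apply: bounded_mfunM => //; exact: bounded_mfun_cst.
  rewrite -rcovZr// -rcovZl//.
  rewrite (_ : (fun x => n%:R * U x) = fun x => S U x + D U x); last first.
    by apply/funext => x; rewrite /D addrC subrK.
  rewrite rcovDl//; [|exact: bS|exact: bD]; congr (_ + _).
  rewrite -rcovDr; [|exact: bS|exact: bD|exact: bS].
  by congr rcov; apply/funext => x; rewrite /D addrC subrK.
have h1 : `|rcov (S U) (S V)| <= n%:R * n%:R * a.
  rewrite [rcov _ _](@rcov_suml n (fun k => \1_(A U k)) (S V)); last 2 first.
  - by move=> i; exact/bounded_mfun_indic/mlev.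
  - exact: bS.
  have -> : n%:R * n%:R * a = \sum_(i < n) \sum_(j < n) a.
    by rewrite !sumr_const !card_ord -mulrnA -[RHS]mulr_natl natrM.
  apply: (le_trans (ler_norm_sum _ _ _)); apply: ler_sum => i _.
  rewrite [rcov _ _](@rcov_sumr n (fun k => \1_(A V k)) (\1_(A U i))); last 2 first.
  - by move=> j; exact/bounded_mfun_indic/mlev.
  - exact/bounded_mfun_indic/mlev.
  apply: (le_trans (ler_norm_sum _ _ _)); apply: ler_sum => j _.
  by rewrite rcov_indic; [exact: ha|exact: mlev|exact: mlev].
have [mSU _] := bS U mU; have [mDU _] := bD U bU; have [mDV _] := bD V bV.
have h2 : `|rcov (S U) (D V)| <= 2 * (n%:R * 1).
  by apply: norm_rcov_le => // x; exact: D01.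
have h3 : `|rcov (D U) (fun x => n%:R * V x)| <= 2 * (1 * n%:R).
  apply: norm_rcov_le => // [|x|x]; [|exact: D01|exact: nW].
  exact: measurable_funM.
have h : n%:R * (n%:R * `|rcov U V|) <= n%:R * n%:R * a + 2 * (n%:R * 1) + 2 * (1 * n%:R).
  rewrite -[X in X * (X * _)]ger0_norm// -!normrM e.
  apply: (le_trans (ler_normD _ _)); rewrite lerD//.
  by apply: (le_trans (ler_normD _ _)); rewrite lerD.
rewrite -(ler_pM2l nR0) -(ler_pM2l nR0) (le_trans h)//.
rewrite le_eqVlt; apply/orP; left; apply/eqP.
have n1 : n%:R != 0 :> R by rewrite gt_eqF.
by field.
Qed.

(** The affine map [N] takes [[-c, c]] to [[0, 1]] and turns level sets into level sets, so the
    normalized case applies. Undoing the scaling in both arguments gives [(2 * c) ^ 2]. *)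
Lemma rcov_le_levels U V a c : measurable_fun setT U -> measurable_fun setT V ->
  (forall x, `|U x| <= c) -> (forall x, `|V x| <= c) ->
  (forall s t, `|fine (P ([set x | s <= U x] `&` [set x | t <= V x])) -
     fine (P [set x | s <= U x]) * fine (P [set x | t <= V x])| <= a) ->
  `|rcov U V| <= 4 * c ^+ 2 * a.
Proof.
move=> mU mV Uc Vc ha.
have bV : bounded_mfun V by split => //; exists c.
have bU : bounded_mfun U by split => //; exists c.
have a0 : 0 <= a by exact: le_trans (ha 0 0).
have [c0|c0] := leP c 0.
  rewrite (_ : U = fun=> 0); first by rewrite rcov_cstl// normr0 mulr_ge0// mulr_ge0// sqr_ge0.
  by apply/funext => x; apply/eqP; rewrite -normr_le0 (le_trans (Uc x)).
pose N W x := (2 * c)^-1 * (c + W x).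
have c2 : 0 < 2 * c by rewrite mulr_gt0.
have bN W : bounded_mfun W -> bounded_mfun (N W).
  move=> bW; apply: bounded_mfunM; first exact: bounded_mfun_cst.
  by apply: bounded_mfunD => //; exact: bounded_mfun_cst.
have N01 W x : `|W x| <= c -> 0 <= N W x <= 1.
  rewrite ler_norml => /andP[cW Wc]; rewrite /N mulr_ge0 ?invr_ge0 ?(ltW c2)//=.
    by rewrite ler_pdivrMl// mulr1 mulr_natl mulr2n lerD2l.
  by rewrite -lerBlDl sub0r.
have lev W s : [set x | s <= N W x] = [set x | 2 * c * s - c <= W x].
  by apply/seteqP; split => x /=; rewrite /N ler_pdivlMl// lerBlDl.
have e W : W = fun x => - c + 2 * c * N W x.
  by apply/funext => x; rewrite /N mulVKf ?gt_eqF// addKr.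
have E : rcov U V = (2 * c) * ((2 * c) * rcov (N U) (N V)).
  rewrite -rcovZr; [|exact: bN|exact: bN].
  rewrite -rcovZl; [|exact: bN|apply: bounded_mfunM; [exact: bounded_mfun_cst|exact: bN]].
  rewrite [in LHS](e U) [in LHS](e V) rcovDl; last first.
  - by rewrite -e.
  - by apply: bounded_mfunM; [exact: bounded_mfun_cst|exact: bN].
  - exact: bounded_mfun_cst.
  rewrite rcov_cstl ?add0r; last by rewrite -e.
  rewrite rcovDr; last first.
  - by apply: bounded_mfunM; [exact: bounded_mfun_cst|exact: bN].
  - by apply: bounded_mfunM; [exact: bounded_mfun_cst|exact: bN].
  - exact: bounded_mfun_cst.
  rewrite [X in X + _]rcovC rcov_cstl ?add0r//.
  by apply: bounded_mfunM; [exact: bounded_mfun_cst|exact: bN].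
rewrite E normrM (normrM (2 * c)) (gtr0_norm c2).
rewrite (_ : 4 * c ^+ 2 * a = (2 * c) * ((2 * c) * a)); last by ring.
rewrite !ler_pM2l//; apply: rcov_le_levels01; try (by move=> x; exact: N01).
- by case: (bN _ bU).
- by case: (bN _ bV).
- by move=> s t; rewrite !lev.
Qed.

Lemma covariance_bounded_mfun U V : bounded_mfun U -> bounded_mfun V ->
  covariance P U V = (rcov U V)%:E.
Proof.
move=> bU bV.
have L1 W : bounded_mfun W -> W \in Lfun P 1.
  by move=> bW; apply/Lfun1_integrable/bounded_mfun_integrable.
rewrite covarianceE; [|exact: L1|exact: L1|exact/L1/bounded_mfunM].
have F W : bounded_mfun W -> ('E_P[W] = (\int[P]_x W x)%:E)%E.
  by move=> bW; rewrite unlock /Rintegral fineK// integrable_fin_num// bounded_mfun_integrable.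
by rewrite !F//; exact: bounded_mfunM.
Qed.

End BoundedCovariance.

(** * Joint law of two successive states of the chain *)

Section MarkovLaw.
Context {R : realType} {dX : measure_display} {X : measurableType dX}.
Variable mu : {sigma_finite_measure set X -> \bar R}.
Variable p : X -> X -> R.
Hypothesis hp : is_transition_density mu p.
Local Open Scope ereal_scope.

Let measurable_p : measurable_fun setT (fun xy : X * X => (p xy.2 xy.1)%:E).
Proof.
apply/measurable_EFinP; case: hp => mp _ _.
apply: (measurableT_comp mp (f := fun xy : X * X => p xy.1 xy.2)
  (g := fun xy : X * X => (xy.2, xy.1))).
exact: measurable_fun_pair.
Qed.

Let p_ge0 x y : 0 <= (p y x)%:E.
Proof. by case: hp => _ p0 _; rewrite lee_fin. Qed.

Let integral_restrict (A : set X) (h g : X -> \bar R) :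
  \int[mu]_(y in A) (h y * g y) = \int[mu]_y (h y * (g \_ A) y).
Proof.
rewrite integral_mkcond; apply: eq_integral => y _; rewrite !patchE.
by case: ifP => //; rewrite mule0.
Qed.

Lemma measurable_transition_integral (A : set X) (g : X -> \bar R) :
  measurable A -> measurable_fun setT g -> (forall y, 0 <= g y) ->
  measurable_fun setT (fun x => \int[mu]_(y in A) ((p y x)%:E * g y)).
Proof.
move=> mA mg g0; under eq_fun do rewrite integral_restrict.
apply: (@measurable_fun_fubini_tonelli_F _ _ X X R mu
  (fun xy => (p xy.2 xy.1)%:E * (g \_ A) xy.2)).
- apply: emeasurable_funM => //.
  apply: (measurableT_comp (f := g \_ A)) => //.
  by apply/(measurable_restrictT _ mA); exact: measurable_funTS.
- by move=> [x y] /=; rewrite mule_ge0// patchE; case: ifP.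
Qed.

Lemma pathint_ge0 (As : seq (set X)) x : 0 <= pathint mu p As x.
Proof.
elim: As x => [|A As IH] x /=; first exact: lee01.
by apply: integral_ge0 => y _; rewrite mule_ge0.
Qed.

Lemma measurable_pathint (As : seq (set X)) :
  (forall i, (i < size As)%N -> measurable (nth set0 As i)) ->
  measurable_fun setT (pathint mu p As).
Proof.
elim: As => [|A As IH] mAs /=; first exact: measurable_cst.
apply: measurable_transition_integral; first exact: (mAs 0%N).
  by apply: IH => i; exact: (mAs i.+1).
by move=> y; exact: pathint_ge0.
Qed.

(** [h'] is the density [h] transported by one step of the chain, the integral of [h x * p y x] over
    [x], and the identity is Tonelli. Extended values spare a proof that [h'] is finite
    everywhere. *)
Lemma integral_transition_swap (h : X -> \bar R) :
  measurable_fun setT h -> (forall x, 0 <= h x) ->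
  exists h' : X -> \bar R, [/\ measurable_fun setT h', (forall x, 0 <= h' x) &
    forall A g, measurable A -> measurable_fun setT g -> (forall y, 0 <= g y) ->
    \int[mu]_x (h x * \int[mu]_(y in A) ((p y x)%:E * g y)) =
    \int[mu]_(y in A) (h' y * g y)].
Proof.
move=> mh h0.
exists (fun y => \int[mu]_x (h x * (p y x)%:E)); split.
- apply: (@measurable_fun_fubini_tonelli_G _ _ X X R mu
    (fun xy => h xy.1 * (p xy.2 xy.1)%:E)).
    by apply: emeasurable_funM => //; exact: (measurableT_comp mh).
  by move=> [x y] /=; rewrite mule_ge0.
- by move=> y; apply: integral_ge0 => x _; rewrite mule_ge0.
move=> A g mA mg g0; rewrite [RHS]integral_restrict.
under eq_integral do rewrite integral_restrict.
have mgA : measurable_fun setT (g \_ A).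
  by apply/(measurable_restrictT _ mA); exact: measurable_funTS.
have gA0 y : 0 <= (g \_ A) y by rewrite patchE; case: ifP.
have mpx x : measurable_fun setT (fun y => (p y x)%:E).
  exact: (measurableT_comp measurable_p (measurable_pair1 x)).
have mpy y : measurable_fun setT (fun x => (p y x)%:E).
  exact: (measurableT_comp measurable_p (measurable_pair2 y)).
transitivity (\int[mu]_x \int[mu]_y (h x * ((p y x)%:E * (g \_ A) y))).
  apply: eq_integral => x _; rewrite ge0_integralZl//.
    exact: emeasurable_funM.
  by move=> y _; rewrite mule_ge0.
rewrite (fubini_tonelli (fun xy => h xy.1 * ((p xy.2 xy.1)%:E * (g \_ A) xy.2)))/=; first last.
- by move=> [x y] /=; rewrite !mule_ge0.
- apply: emeasurable_funM; first exact: (measurableT_comp mh).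
  by apply: emeasurable_funM => //; exact: (measurableT_comp mgA).
apply: eq_integral => y _; rewrite -[RHS]ge0_integralZr//.
- by apply: eq_integral => x _; rewrite muleA.
- exact: emeasurable_funM.
- by move=> x _; rewrite mule_ge0.
Qed.

(** Each leading [setT] is an unconstrained coordinate and is integrated out by one transport step.
    Started from the initial density, [h'] is the density of the state at time [n]. *)
Lemma integral_pathint_nseq (n : nat) (h : X -> \bar R) :
  measurable_fun setT h -> (forall x, 0 <= h x) ->
  exists h' : X -> \bar R, [/\ measurable_fun setT h', (forall x, 0 <= h' x) &
    forall As, (forall i, (i < size As)%N -> measurable (nth set0 As i)) ->
    \int[mu]_x (h x * pathint mu p (nseq n setT ++ As) x) =
    \int[mu]_x (h' x * pathint mu p As x)].
Proof.
elim: n h => [|n IH] h mh h0; first by exists h; split.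
have [h1 [mh1 h10 h1E]] := integral_transition_swap mh h0.
have [h2 [mh2 h20 h2E]] := IH h1 mh1 h10.
exists h2; split => // As mAs; rewrite -h2E//= h1E//.
- apply: measurable_pathint => i; rewrite size_cat size_nseq nth_cat size_nseq => ilt.
  case: ifPn => [ni|]; first by rewrite nth_nseq ni.
  by rewrite -leqNgt => ni; apply: mAs; rewrite ltn_subLR.
- by move=> y; exact: pathint_ge0.
Qed.

Context {dO : measure_display} {Omega : measurableType dO}.
Variables (P : probability Omega R) (Xs : nat -> Omega -> X) (q : X -> R).
Hypothesis hq : is_prob_density mu q.
Hypothesis hchain : markov_chain_law mu q p P Xs.

Let mXs i : measurable_fun setT (Xs i). Proof. by case: hchain. Qed.

Lemma markov_pair_law (i : nat) : exists h : X -> \bar R,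
  [/\ measurable_fun setT h, (forall x, 0 <= h x) & forall A B,
    measurable A -> measurable B ->
    P [set w | A (Xs i w) /\ B (Xs i.+1 w)] =
    \int[mu]_(x in A) (h x * \int[mu]_(y in B) (p y x)%:E)].
Proof.
have [mq q0 _] := hq; have [_ hlaw] := hchain.
have mqE : measurable_fun setT (EFin \o q) by exact/measurable_EFinP.
case: i => [|n].
  exists (EFin \o q); split => // A B mA mB.
  have := hlaw A [:: B] mA; rewrite /=.
  under eq_integral do under eq_integral do rewrite mule1.
  move=> <-; last by case.
  congr (P _); apply/seteqP; split => w /= [Aw Bw]; split => //.
    by case.
  exact: (Bw 0%N).
(* Here [h] is the density at time [n], and one more transport gives [h'] at time [n.+1]. Time 0 is
   treated apart because there [A] constrains the initial state itself. *)
have [h [mh h0 hE]] := integral_pathint_nseq n mqE q0.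
have [h' [mh' h'0 h'E]] := integral_transition_swap mh h0.
exists h'; split => // A B mA mB.
have nthE k : nth set0 (nseq n setT ++ [:: A; B]) k =
    if (k < n)%N then setT else nth set0 [:: A; B] (k - n).
  by rewrite nth_cat size_nseq nth_nseq; case: (k < n)%N.
have mAB k : (k < 2)%N -> measurable (nth set0 [:: A; B] k).
  by case: k => [|[|]].
have := hlaw setT (nseq n setT ++ [:: A; B]) measurableT; rewrite hE// /=.
under eq_integral do under eq_integral do under eq_integral do rewrite mule1.
rewrite h'E//; last first.
- by move=> y; apply: integral_ge0.
- have := @measurable_transition_integral B (cst 1) mB (measurable_cst _) (fun=> lee01).
  by under eq_fun do under eq_integral do rewrite mule1.
move=> <-.
  congr (P _); apply/seteqP; split => w /=.
    move=> [Aw Bw]; split => // k; rewrite size_cat size_nseq nthE => klt.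
    case: ifPn => //; rewrite -leqNgt => nk.
    have : (k - n < 2)%N by rewrite ltn_subLR.
    have -> : k = (n + (k - n))%N by rewrite subnKC.
    by rewrite addKn; case: (k - n)%N => [|[|]]//= _; rewrite ?addn0 ?addn1.
  move=> [_ H]; split.
    have := H n; rewrite size_cat size_nseq nthE ltnn subnn; apply.
    by rewrite -[X in (X < _)%N]addn0 ltn_add2l.
  have := H n.+1; rewrite size_cat size_nseq nthE [(n.+1 < n)%N]ltnNge leqnSn subSnn; apply.
  by rewrite -addn1 ltn_add2l.
move=> k; rewrite size_cat size_nseq nthE => klt.
by case: ifPn => //; rewrite -leqNgt => nk; apply: mAB; rewrite ltn_subLR.
Qed.
End MarkovLaw.

(** * The measure with a given density *)

Section DensityMeasure.
Context {R : realType} {d : measure_display} {T : measurableType d}.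
Variables (mu : {measure set T -> \bar R}) (f : T -> \bar R).
Local Open Scope ereal_scope.

(* The two proofs are arguments so that the measure structure below can be inferred. *)
Definition density_measure of measurable_fun setT f & (forall x, 0 <= f x) :=
  fun A => \int[mu]_(x in A) f x.

Hypotheses (mf : measurable_fun setT f) (f0 : forall x, 0 <= f x).
Local Notation nu := (density_measure mf f0).

Let density_measure0 : nu set0 = 0.
Proof. by rewrite /nu integral_set0. Qed.

Let density_measure_ge0 A : 0 <= nu A.
Proof. exact: integral_ge0. Qed.

Let density_measure_sigma_additive : semi_sigma_additive nu.
Proof.
move=> /= A mA tA mUA; rewrite /nu ge0_integral_bigcup//=.
  by apply: is_cvg_ereal_nneg_natsum_cond => n _ _; exact: integral_ge0.
exact: measurable_funTS.
Qed.

HB.instance Definition _ := isMeasure.Build _ _ _ nu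
  density_measure0 density_measure_ge0 density_measure_sigma_additive.

End DensityMeasure.

(** * Almost sure positivity of the densities along the chain *)

Section PositiveDensity.
Context {R : realType} {dX : measure_display} {X : measurableType dX}.
Variable mu : {sigma_finite_measure set X -> \bar R}.
Variables (p : X -> X -> R) (q : X -> R).
Hypotheses (hp : is_transition_density mu p) (hq : is_prob_density mu q).
Context {dO : measure_display} {Omega : measurableType dO}.
Variables (P : probability Omega R) (Xs : nat -> Omega -> X).
Hypothesis hchain : markov_chain_law mu q p P Xs.
Local Open Scope ereal_scope.

Lemma initial_density_null : P [set w | q (Xs 0%N w) = 0%R] = 0.
Proof.
have [mq _ _] := hq; have [_ hlaw] := hchain.
have mA : measurable (q @^-1` [set 0%R]) by rewrite -[X in measurable X]setTI; apply: mq.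
have := hlaw _ [::] mA; rewrite /=.
rewrite integral0_eq; last by move=> x /= ->; rewrite mul0e.
move=> <- //; congr (P _); apply/seteqP; split => w /=; last by case.
by move=> ->; split.
Qed.

(** The law of two successive states agrees on rectangles with the measure of density [h x * p y x],
    hence on all measurable sets. On [N] this density is zero. *)
Lemma transition_density_null i : P [set w | p (Xs i.+1 w) (Xs i w) = 0%R] = 0.
Proof.
have [mp p0 _] := hp; have [mXs _] := hchain.
have [h [mh h0 hE]] := markov_pair_law hp hq hchain i.
pose f (xy : X * X) : \bar R := h xy.1 * (p xy.2 xy.1)%:E.
have mp' : measurable_fun setT (fun xy : X * X => p xy.2 xy.1).
  exact: (measurableT_comp mp (f := fun xy : X * X => p xy.1 xy.2)
    (measurable_swap (T1 := X) (T2 := X))).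
have mf : measurable_fun setT f.
  apply: emeasurable_funM; first exact: (measurableT_comp mh).
  exact/measurable_EFinP.
have f0 z : 0 <= f z by rewrite /f mule_ge0 ?lee_fin.
pose m2 := density_measure (mu \x mu) mf f0.
have mphi : measurable_fun setT (fun w => (Xs i w, Xs i.+1 w)) by exact: measurable_fun_pair.
pose phi : {mfun Omega >-> (X * X)%type} := mfun_Sub (mem_set mphi).
pose m1 := pushforward P phi.
pose N := [set xy : X * X | p xy.2 xy.1 = 0%R].
have mN : measurable N.
  rewrite (_ : N = setT `&` (fun xy : X * X => p xy.2 xy.1) @^-1` [set 0%R]).
    exact: mp'.
  by rewrite setTI.
suff : m1 N = m2 N.
  rewrite /m1 /pushforward /= => ->.
  by apply: integral0_eq => -[x y] /= e; rewrite /f /= e mule0.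
(* Rectangles form a generating pi-system, and the constant cover [setT] is admissible because [m1]
   has finite mass. *)
apply: (@measure_unique _ _ _ [set A `*` B | A in measurable & B in measurable] (fun=> setT)) => //.
- by rewrite measurable_prod_measurableType.
- move=> _ _ [A mA [B mB <-]] [A' mA' [B' mB' <-]].
  rewrite -setXI; exists (A `&` A'); first exact: measurableI.
  by exists (B `&` B') => //; exact: measurableI.
- by move=> _; exists setT => //; exists setT => //; rewrite setXTT.
- by rewrite bigcup_const.
- move=> _ [A mA [B mB <-]].
  rewrite /m1 /pushforward /= /m2 /density_measure.
  rewrite [LHS](_ : _ = P [set w | A (Xs i w) /\ B (Xs i.+1 w)])// hE//.
  rewrite [RHS]integral_mkcond fubini_tonelli1; last 2 first.
  + apply/(measurable_restrictT _ (measurableX mA mB)); exact: measurable_funTS.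
  + by move=> z; rewrite patchE; case: ifP.
  rewrite integral_mkcond; apply: eq_integral => x _; rewrite /fubini_F patchE.
  case: ifPn => xA.
    rewrite -ge0_integralZl//.
    - rewrite [LHS]integral_mkcond; apply: eq_integral => y _.
      by rewrite !patchE in_setX xA.
    - apply/measurable_EFinP/measurable_funTS.
      exact: (measurableT_comp mp' (measurable_pair1 x)).
    - by move=> y _; rewrite lee_fin.
  by rewrite integral0_eq// => y _; rewrite patchE in_setX (negbTE xA).
- move=> _; apply: (le_lt_trans (@probability_le1 _ _ _ P (phi @^-1` setT) _)); last exact: ltry.
  by rewrite preimage_setT.
Qed.

End PositiveDensity.

(** * Mixing coefficients and covariances of one-step functionals *)

Section Mixing.
Context {R : realType} {dX : measure_display} {X : measurableType dX}.
Context {dO : measure_display} {Omega : measurableType dO}.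
Variables (P : probability Omega R) (Xs : nat -> Omega -> X).
Hypothesis mXs : forall i, measurable_fun setT (Xs i).

(** On [Omega] equipped with the generated sigma-algebra alone, both coordinates are measurable by
    construction, hence so is the pair. This puts level sets of one-step functionals into the past
    or the future. *)
Lemma sigma_gen_pair (I : set nat) i j (C : set (X * X)) : I i -> I j -> measurable C ->
  sigma_gen Xs I [set w | C (Xs i w, Xs j w)].
Proof.
move=> Ii Ij mC.
pose G := \bigcup_(i in I) [set Xs i @^-1` A | A in (@measurable _ X)].
have mX k : I k -> measurable_fun (setT : set (g_sigma_algebraType G)) (Xs k).
  move=> Ik _ A mA; rewrite setTI; apply: sub_sigma_algebra.
  by exists k => //; exists A.
have := measurable_fun_pair (mX i Ii) (mX j Ij) measurableT mC.
by rewrite setTI.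
Qed.

Lemma sigma_gen_measurable (I : set nat) (A : set Omega) : sigma_gen Xs I A -> measurable A.
Proof.
apply: smallest_sub; first exact: sigma_algebra_measurable.
by move=> _ [i _ [B mB <-]]; rewrite -[X in measurable X]setTI; exact: mXs.
Qed.

Lemma mixing_term_le1 (A B : set Omega) : measurable A -> measurable B ->
  `|fine (P (A `&` B)) - fine (P A) * fine (P B)| <= 1.
Proof.
have F (C : set Omega) : measurable C -> 0 <= fine (P C) <= 1.
  move=> mC; rewrite fine_ge0//= -lee_fin fineK ?probability_le1//.
  by rewrite ge0_fin_numE// (le_lt_trans (probability_le1 P mC))// ltry.
move=> mA mB; have /andP[x0 x1] := F _ (measurableI _ _ mA mB).
have /andP[a0 a1] := F _ mA; have /andP[b0 b1] := F _ mB.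
have ab0 := mulr_ge0 a0 b0; have ab1 := mulr_ile1 a0 b0 a1 b1.
by rewrite ler_norml; apply/andP; split; lra.
Qed.

Lemma alpha_mix_ge t k A B : sigma_past Xs t A -> sigma_future Xs (t + k) B ->
  `|fine (P (A `&` B)) - fine (P A) * fine (P B)| <= alpha_mix P Xs k.
Proof.
move=> pA fB; apply: ub_le_sup; last by exists t, A, B.
(* The real-valued [sup] dominates its elements only when the set is bounded above; 1 is a bound. *)
exists 1 => _ [s [A' [B' [pA' fB' ->]]]].
by apply: mixing_term_le1; apply: sigma_gen_measurable; [exact: pA'|exact: fB'].
Qed.

Lemma sigma_gen0 (I : set nat) : sigma_gen Xs I set0.
Proof.
have [] : sigma_algebra setT (sigma_gen Xs I) by exact: smallest_sigma_algebra.
by [].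
Qed.

Lemma alpha_mix_ge0 k : 0 <= alpha_mix P Xs k.
Proof.
apply: le_trans (normr_ge0 _) (@alpha_mix_ge 0 k set0 set0 _ _); exact: sigma_gen0.
Qed.

Lemma alpha_mix_le1 k : alpha_mix P Xs k <= 1.
Proof.
apply: ge_sup.
  exists `|fine (P (set0 `&` set0)) - fine (P set0) * fine (P set0)|.
  by exists 0%N, set0, set0; split => //; exact: sigma_gen0.
move=> _ [s [A' [B' [pA' fB' ->]]]].
by apply: mixing_term_le1; apply: sigma_gen_measurable; [exact: pA'|exact: fB'].
Qed.

Lemma alpha_mix_summable (r : R) : 0 < r <= 1 ->
  cvgn (fun N => \sum_(1 <= k < N) alpha_mix P Xs k `^ r) ->
  exists L : R, forall N, \sum_(1 <= k < N) alpha_mix P Xs k <= L.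
Proof.
move=> /andP[r0 r1] hcvg; exists (limn (fun N => \sum_(1 <= k < N) alpha_mix P Xs k `^ r)) => N.
apply: le_trans (_ : _ <= \sum_(1 <= k < N) alpha_mix P Xs k `^ r) _.
  (* A number in []0, 1]] is at most its power of exponent at most 1; the value 0 is treated
     separately. *)
  apply: ler_sum => k _; have := alpha_mix_ge0 k; rewrite le_eqVlt => /predU1P[<-|a0].
    exact: powR_ge0.
  by apply: ger1_powR => //; rewrite a0 alpha_mix_le1.
apply: (nondecreasing_cvgn_le _ hcvg N) => a b ab.
case: (ltnP a 1) => [|a1].
  rewrite ltnS leqn0 => /eqP ->; rewrite big_geq//.
  by apply: sumr_ge0 => k _; exact: powR_ge0.
rewrite (big_cat_nat a1 ab)/= lerDl.
by apply: sumr_ge0 => k _; exact: powR_ge0.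
Qed.

(* [step_corr k] bounds the correlation of two one-step functionals whose indices differ by [k]:
   they depend on blocks of coordinates that are [k - 1] steps apart. *)
Definition step_corr (k : nat) : R := if (k <= 1)%N then 1 else alpha_mix P Xs k.-1.

(** The 2 comes from the lags 0 and 1; from lag 2 on the terms are the mixing coefficients of index
    1, 2, and so on. *)
Lemma sum_step_corr_le (L : R) : (forall N, \sum_(1 <= k < N) alpha_mix P Xs k <= L) ->
  forall n, \sum_(k < n) step_corr k <= 2 + L.
Proof.
move=> hL [|[|n]].
- by rewrite big_ord0 addr_ge0// (le_trans _ (hL 0%N))// big_geq.
- rewrite big_ord1 /step_corr /= (le_trans (_ : _ <= 2 + 0))//; first by rewrite addr0 ler1n.
  by rewrite lerD2l (le_trans _ (hL 0%N))// big_geq.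
rewrite 2!big_ord_recl /= /step_corr /= addrA lerD// (le_trans _ (hL n.+1))//.
rewrite big_add1 /= big_mkord le_eqVlt; apply/orP; left; apply/eqP.
by apply: eq_bigr => i _.
Qed.

Section Functional.
Variables (z : X -> X -> R) (c : R).
Hypothesis mz : measurable_fun setT (fun yx : X * X => z yx.1 yx.2).
Hypothesis zc : forall y x, `|z y x| <= c.
Let Z i w := z (Xs i.+1 w) (Xs i w).

Lemma measurable_step_functional i : measurable_fun setT (Z i).
Proof.
have mp : measurable_fun setT (fun w => (Xs i.+1 w, Xs i w)) by exact: measurable_fun_pair.
exact: (measurableT_comp mz mp).
Qed.

Let Z_bounded i : bounded_mfun (Z i).
Proof. by split; [exact: measurable_step_functional|exists c => x; exact: zc]. Qed.

Lemma rcov_step_functional_le i k :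
  `|rcov P (Z i) (Z (i + k)%N)| <= 4 * c ^+ 2 * step_corr k.
Proof.
have mZ := measurable_step_functional.
rewrite /step_corr; case: ifPn => [_|]; last first.
  rewrite -ltnNge => k1; apply: rcov_le_levels => //; try (by move=> w; exact: zc).
  move=> s t.
  have mS u : measurable [set yx : X * X | u <= z yx.1 yx.2].
    rewrite (_ : [set _ | _] = setT `&` (fun yx : X * X => z yx.1 yx.2) @^-1` `[u, +oo[).
      exact: mz.
    by rewrite setTI; apply/seteqP; split => yx /=; rewrite in_itv/= andbT.
  (* [Z i] sees the past up to [i.+1], and [Z (i + k)] the future from [i + k], which is
     [i.+1 + k.-1]. *)
  apply: (@alpha_mix_ge i.+1 k.-1).
    by apply: (@sigma_gen_pair _ i.+1 i _ _ _ (mS s)) => /=.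
  apply: (@sigma_gen_pair _ (i + k).+1 (i + k)%N _ _ _ (mS t)) => /=.
    by rewrite addSn -addnS prednK ?(ltnW k1)// leqW.
  by rewrite addSn -addnS prednK ?(ltnW k1).
(* For lags 0 and 1 the two blocks share a coordinate; the crude bound [2 * c ^ 2] suffices. *)
apply: le_trans (norm_rcov_le P (mZ _) (mZ _) (a := c) (b := c) _ _) _.
- by move=> w; exact: zc.
- by move=> w; exact: zc.
- by rewrite mulr1 expr2 ler_wpM2r ?ler_nat// -expr2 sqr_ge0.
Qed.

(** Adding [Z n] adds its variance and twice its covariances with the earlier terms. This is at most
    twice the sum of [4 * c ^ 2 * step_corr k] over all lags, which explains the 8. *)
Lemma rcov_sum_step_functional_le (S : R) n : (forall n, \sum_(k < n) step_corr k <= S) ->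
  rcov P (fun w => \sum_(i < n) Z i w) (fun w => \sum_(i < n) Z i w) <=
    n%:R * (8 * c ^+ 2 * S).
Proof.
move=> hS.
have c4 : 0 <= 4 * c ^+ 2 by rewrite mulr_ge0// sqr_ge0.
elim: n => [|n IH].
  under eq_fun do rewrite big_ord0.
  by rewrite rcov_cstl ?mul0r//; exact: bounded_mfun_cst.
pose W := fun w => \sum_(i < n) Z i w.
have bW : bounded_mfun W by apply: (@bounded_mfun_sum _ _ _ n Z).
rewrite (_ : (fun w => _) = fun w => W w + Z n w); last first.
  by apply/funext => w; rewrite big_ord_recr.
have bWZ : bounded_mfun (fun w => W w + Z n w) by exact: bounded_mfunD.
have h : \sum_(i < n.+1) `|rcov P (Z i) (Z n)| <= 4 * c ^+ 2 * S.
  apply: le_trans (_ : _ <= 4 * c ^+ 2 * \sum_(k < n.+1) step_corr k) _; last first.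
    by rewrite ler_wpM2l.
  (* Reversing the order of summation makes the index equal to the lag. *)
  rewrite (reindex_inj rev_ord_inj)/= mulr_sumr; apply: ler_sum => i _; rewrite subSS.
  have := rcov_step_functional_le (n - i) i; rewrite subnK//.
  by rewrite -ltnS.
have h' : rcov P W (Z n) <= \sum_(i < n) `|rcov P (Z i) (Z n)|.
  by rewrite (@rcov_suml _ _ _ P n Z)//; apply: ler_sum => i _; exact: ler_norm.
rewrite rcovDl// !rcovDr// -natr1 mulrDl mul1r -addrA; apply: lerD => //.
rewrite [rcov P (Z n) W]rcovC.
have -> : 8 * c ^+ 2 * S = 4 * c ^+ 2 * S + 4 * c ^+ 2 * S by ring.
rewrite big_ord_recr /= in h.
have hn := ler_norm (rcov P (Z n) (Z n)); have hn0 := normr_ge0 (rcov P (Z n) (Z n)).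
lra.
Qed.

End Functional.
End Mixing.

(** The integral of the positive part is a supremum over simple functions below it, all of which lie
    below [g]. In the applications [f] is known only through a pointwise bound. *)
Lemma integral_le_ge0 {R : realType} {d : measure_display} {T : measurableType d}
  (mu : {measure set T -> \bar R}) (f g : T -> \bar R) :
  (forall x, f x <= g x)%E -> (forall x, 0 <= g x)%E ->
  (\int[mu]_x f x <= \int[mu]_x g x)%E.
Proof.
move=> fg g0; rewrite integralE.
apply: (@le_trans _ _ (\int[mu]_x (f^\+ x))%E).
  by apply: geeDl; rewrite oppe_le0; exact: integral_ge0.
rewrite !ge0_integralTE//; apply: ereal_sup_le => _ [h hf <-]; exists h => // x.
by apply: le_trans (hf x) _; rewrite funeposE ge_max fg g0.
Qed.

(** * Mean and variance of the log-likelihood ratio at a fixed parameter *)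

Section LogLikelihoodRatio.
Context {R : realType} {dX : measure_display} {X : measurableType dX}.
Variable mu : {sigma_finite_measure set X -> \bar R}.
Context {dT : measure_display} {Theta : measurableType dT}.
Variables (p : Theta -> X -> X -> R) (q : X -> R).
Hypotheses (hq : is_prob_density mu q) (hp : forall th, is_transition_density mu (p th)).
Context {dO : measure_display} {Omega : measurableType dO}.
Variables (P : probability Omega R) (Xs : nat -> Omega -> X) (theta0 : Theta).
Hypothesis hchain : markov_chain_law mu q (p theta0) P Xs.

Let mXs i : measurable_fun setT (Xs i). Proof. by case: hchain. Qed.

Lemma path_density_ge0 th n w : 0 <= path_density q (p th) Xs n w.
Proof.
have [_ q0 _] := hq; have [_ p0 _] := hp th.
by rewrite mulr_ge0// prodr_ge0.
Qed.

Lemma measurable_path_density th n : measurable_fun setT (path_density q (p th) Xs n).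
Proof.
have [mq q0 _] := hq; have [mp p0 _] := hp th.
apply: (measurable_funM (f := q \o Xs 0%N)
  (g := fun w => \prod_(i < n) p th (Xs i.+1 w) (Xs i w))).
  exact: measurableT_comp.
elim: n => [|n IH]; first by under eq_fun do rewrite big_ord0; exact: measurable_cst.
under eq_fun do rewrite big_ord_recr.
by apply: measurable_funM => //; exact: (measurable_step_functional mXs mp n).
Qed.

Lemma path_density_null n : P [set w | path_density q (p theta0) Xs n w = 0] = 0%E.
Proof.
have mE m : measurable [set w | path_density q (p theta0) Xs m w = 0].
  rewrite -[X in measurable X]setTI.
  exact: (@measurable_path_density theta0 m measurableT [set 0]).
suff [A [mA A0 sub]] : P.-negligible [set w | path_density q (p theta0) Xs n w = 0].
  by apply/eqP; rewrite eq_le measure_ge0 andbT -A0 le_measure// inE.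
elim: n => [|n IH].
  exists [set w | path_density q (p theta0) Xs 0 w = 0]; split => //.
  rewrite -(initial_density_null hq hchain); congr (P _); apply/seteqP.
  by split => w; rewrite /path_density /= big_ord0 mulr1.
apply: (@negligibleS _ _ _ P
  ([set w | path_density q (p theta0) Xs n w = 0] `|` [set w | p theta0 (Xs n.+1 w) (Xs n w) = 0])).
  move=> w /=; rewrite /path_density big_ord_recr/= mulrA => /eqP.
  by rewrite mulf_eq0 => /orP[/eqP ?|/eqP ?]; [left|right].
apply: negligibleU => //.
exists [set w | p theta0 (Xs n.+1 w) (Xs n w) = 0]; split => //; last first.
  exact: (transition_density_null (hp theta0) hq hchain n).
rewrite -[X in measurable X]setTI.
have [mp _ _] := hp theta0.
exact: (measurable_step_functional mXs mp n measurableT (Y := [set 0])).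
Qed.

Lemma ln_path_density th n w : 0 < path_density q (p th) Xs n w ->
  ln (path_density q (p th) Xs n w) =
    ln (q (Xs 0%N w)) + \sum_(i < n) ln (p th (Xs i.+1 w) (Xs i w)).
Proof.
have [_ q0 _] := hq; have [_ p0 _] := hp th.
elim: n => [|n IH]; rewrite /path_density ?big_ord0 ?mulr1 ?addr0// !big_ord_recr/= mulrA.
rewrite -/(path_density q (p th) Xs n w) => h.
have := path_density_ge0 th n w; rewrite le_eqVlt => /predU1P[e|d0].
  by move: h; rewrite -e mul0r ltxx.
have p1 : 0 < p th (Xs n.+1 w) (Xs n w) by rewrite -(pmulr_rgt0 _ d0).
by rewrite lnM ?posrE// IH// addrA.
Qed.

Variables (th : Theta) (c : R).
Hypothesis hz : forall x y, (p theta0 y x = 0 /\ p th y x = 0) \/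
  [/\ 0 < p theta0 y x, 0 < p th y x & `|ln (p theta0 y x) - ln (p th y x)| <= c].
Let z (y x : X) := ln (p theta0 y x) - ln (p th y x).
Hypothesis c0 : 0 <= c.

Let zc y x : `|z y x| <= c.
Proof.
case: (hz x y) => [[e1 e2]|[]//].
by rewrite /z e1 e2 subrr normr0.
Qed.

Let mz : measurable_fun setT (fun yx : X * X => z yx.1 yx.2).
Proof.
have [mp0 _ _] := hp theta0; have [mp _ _] := hp th.
apply: measurable_funB.
  exact: (measurableT_comp (@measurable_ln R) mp0).
exact: (measurableT_comp (@measurable_ln R) mp).
Qed.

Let E n := [set w | path_density q (p theta0) Xs n w != 0].
Let W n w := \sum_(i < n) z (Xs i.+1 w) (Xs i w).

(** Off [E n] the ratio is 0 and [ln 0 = 0], while [W n] need not vanish there, hence the indicator.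
    On [E n], [hz] carries positivity over to [th], and the common initial factor cancels. *)
Lemma r_n_indic n w : r_n q p Xs n th theta0 w = \1_(E n) w * W n w.
Proof.
have [_ q0 _] := hq.
rewrite /r_n indicE; have [e|d0] := eqVneq (path_density q (p theta0) Xs n w) 0.
  rewrite e mul0r ln0// memNset ?mul0r//.
  by rewrite /E /= e eqxx.
rewrite mem_set// mul1r.
have pos0 : 0 < path_density q (p theta0) Xs n w by rewrite lt_def d0 path_density_ge0.
have pos1 : 0 < path_density q (p th) Xs n w.
  rewrite lt_def path_density_ge0 andbT; move: d0; rewrite /path_density !mulf_eq0 !negb_or.
  move=> /andP[-> /=]; rewrite !prodf_seq_neq0; apply: sub_all => i /=.
  by case: (hz (Xs i w) (Xs i.+1 w)) => [[-> _]|[_ pth _] _]; [rewrite eqxx|rewrite gt_eqF].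
rewrite ln_div ?posrE// !ln_path_density// opprD addrACA subrr add0r.
by rewrite /W sumrB.
Qed.

Lemma measurable_E n : measurable (E n).
Proof.
rewrite (_ : E n = setT `&` path_density q (p theta0) Xs n @^-1` (~` [set 0])).
  apply: measurable_path_density => //; exact: measurableC.
by rewrite setTI; apply/seteqP; split => w /= /eqP.
Qed.

Lemma norm_log_ratio_le n w : `|W n w| <= n%:R * c.
Proof.
apply: le_trans (ler_norm_sum _ _ _) _.
rewrite -[n in n%:R]card_ord mulr_natl -sumr_const.
by apply: ler_sum => i _; exact: zc.
Qed.

Lemma KL_path_le n : (KL_path P q p Xs n theta0 th <= (n%:R * c)%:E)%E.
Proof.
rewrite /KL_path unlock.
apply: (@le_trans _ _ (\int[P]_w (n%:R * c)%:E)%E).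
  apply: integral_le_ge0 => w; last by rewrite lee_fin mulr_ge0.
  rewrite lee_fin r_n_indic; apply: le_trans (ler_norm _) _; rewrite normrM.
  rewrite -[X in _ <= X]mul1r ler_pM ?norm_log_ratio_le//.
  by rewrite indicE; case: (_ \in _); rewrite ?normr1 ?normr0.
by rewrite integral_cst//= probability_setT mule1.
Qed.

Let Rintegral_indic_E n (U : Omega -> R) : measurable_fun setT U ->
  \int[P]_w (\1_(E n) w * U w) = \int[P]_w U w.
Proof.
move=> mU; congr fine; apply: ae_eq_integral => //.
- apply/measurable_EFinP; apply: measurable_funM => //.
  exact/measurable_indic/measurable_E.
- exact/measurable_EFinP.
exists [set w | path_density q (p theta0) Xs n w = 0]; split.
- rewrite (_ : [set _ | _] = ~` E n); first exact/measurableC/measurable_E.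
  by apply/seteqP; split => w /=; rewrite /E /=; [move=> -> /eqP|move/negP; rewrite negbK => /eqP].
- exact: path_density_null.
- move=> w /= H; apply/eqP/negPn/negP => h; apply: H => _.
  by rewrite indicE mem_set// mul1r.
Qed.

Lemma variance_log_ratio_le n (S : R) :
  (forall n, \sum_(k < n) step_corr P Xs k <= S) ->
  ('V_P[r_n q p Xs n th theta0] <= (n%:R * (8 * c ^+ 2 * S))%:E)%E.
Proof.
move=> hS.
have bW : bounded_mfun (W n).
  apply: (@bounded_mfun_sum _ _ _ n (fun i w => z (Xs i.+1 w) (Xs i w))) => i _.
  by split; [exact: (measurable_step_functional mXs mz i)|exists c => w; exact: zc].
have bE : bounded_mfun (\1_(E n) : Omega -> R) by exact/bounded_mfun_indic/measurable_E.
rewrite (_ : r_n _ _ _ _ _ _ = fun w => \1_(E n) w * W n w); last first.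
  by apply/funext => w; exact: r_n_indic.
rewrite /variance covariance_bounded_mfun; [|exact: bounded_mfunM|exact: bounded_mfunM].
rewrite lee_fin; have [mW _] := bW.
apply: le_trans (rcov_sum_step_functional_le mXs mz zc n hS).
(* [E n] has full probability, so its indicator drops out of the integrals. The product carries the
   square of the indicator, which is the indicator again. *)
rewrite /rcov Rintegral_indic_E// -(Rintegral_indic_E n (measurable_funM mW mW)).
rewrite le_eqVlt; apply/orP; left; apply/eqP; congr (_ - _).
apply: eq_Rintegral => w _; rewrite indicE.
by case: (_ \in _); rewrite ?mul1r// !mul0r.
Qed.

End LogLikelihoodRatio.

(** * Auxiliary measure structure and moment inequalities *)

Section SigmaFiniteCopy.
Context {d : measure_display} {T : measurableType d} {R : realType}.
Variable mu : {measure set T -> \bar R}.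

(* The proof is an argument so that the sigma-finite structure below can be inferred. *)
Definition sigma_finite_copy of sigma_finite setT mu : set T -> \bar R := mu.

Hypothesis h : sigma_finite setT mu.
HB.instance Definition _ := Measure.copy (sigma_finite_copy h) mu.
HB.instance Definition _ := Measure_isSigmaFinite.Build _ _ _ (sigma_finite_copy h) h.

End SigmaFiniteCopy.

(** Expand the square and bound each product by [a k ^+ 2 + a l ^+ 2]. Cauchy-Schwarz would save the
    factor 2, which is immaterial here. *)
Lemma sqr_sum_le {R : realDomainType} (m : nat) (a : 'I_m -> R) :
  (\sum_(k < m) a k) ^+ 2 <= 2 * m%:R * \sum_(k < m) a k ^+ 2.
Proof.
have -> : 2 * m%:R * \sum_(k < m) a k ^+ 2 =
    \sum_(k < m) \sum_(l < m) (a k ^+ 2 + a l ^+ 2).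
  under [RHS]eq_bigr do rewrite big_split /= sumr_const card_ord.
  rewrite big_split /= sumr_const card_ord sumrMnl -mulr_natl.
  ring.
rewrite expr2 mulr_suml; apply: ler_sum => k _.
rewrite mulr_sumr; apply: ler_sum => l _.
have := sqr_ge0 (a k - a l); have := sqr_ge0 (a k); have := sqr_ge0 (a l); nra.
Qed.

Lemma sqr_le_norm_powR {R : realType} (x delta : R) : 0 < delta ->
  `|x| ^+ 2 <= `|x| + `|x| `^ (2 + delta).
Proof.
move=> d0; have [x1|x1] := leP `|x| 1.
  by rewrite expr2 ler_wpDr ?powR_ge0// ler_piMl.
rewrite ler_wpDl// -powR_mulrn// ler_powR ?(ltW x1)//.
by rewrite lerDl ltW.
Qed.

Lemma integral_scaled_sum_le {R : realType} {d : measure_display} {T : measurableType d}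
  (P : probability T R) (m : nat) (g : 'I_m -> T -> R) (a t : R) :
  0 <= a -> (forall k, measurable_fun setT (g k)) -> (forall k x, 0 <= g k x) ->
  (forall k, \int[P]_x (g k x)%:E <= t%:E)%E ->
  (\int[P]_x (a * \sum_(k < m) g k x)%:E <= (a * (m%:R * t))%:E)%E.
Proof.
move=> a0 mg g0 ht.
have mgE k : measurable_fun setT (fun x => (g k x)%:E) by exact/measurable_EFinP.
under eq_integral do rewrite EFinM -sumEFin.
rewrite ge0_integralZl//; last first.
- by move=> x _; apply: sume_ge0 => k _; rewrite lee_fin.
- exact: emeasurable_sum.
rewrite ge0_integral_sum//; last by move=> k x _; rewrite lee_fin.
rewrite EFinM lee_wpmul2l ?lee_fin//.
apply: (@le_trans _ _ (\sum_(k < m) t%:E)%E); first by apply: lee_sum => k _; exact: ht.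
by rewrite sumEFin sumr_const card_ord mulr_natl.
Qed.

(** * Integration over the parameter and choice of constants *)

Unset Implicit Arguments.
Theorem mainTheorem9
  (R : realType)
  (dX : measure_display) (X : measurableType dX)
  (mu : {measure set X -> \bar R}) (hmu : sigma_finite setT mu)
  (dT : measure_display) (Theta : measurableType dT)
  (p : Theta -> X -> X -> R) (q0 : X -> R)
  (hq0 : is_prob_density mu q0)
  (hp : forall th, is_transition_density mu (p th))
  (hpm : measurable_fun setT (fun z : Theta * (X * X) => p z.1 z.2.1 z.2.2))
  (theta0 : Theta)
  (dO : measure_display) (Omega : measurableType dO)
  (P : probability Omega R) (Xs : nat -> Omega -> X)
  (hchain : markov_chain_law mu q0 (p theta0) P Xs)
  (delta : R) (hdelta : 0 < delta)
  (hmix : cvgn (fun N => \sum_(1 <= k < N) alpha_mix P Xs k `^ (delta / (2 + delta))))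
  (m : nat) (B : R)
  (M : 'I_m -> X -> X -> R) (f : 'I_m -> Theta -> Theta -> R)
  (hMm : forall k, measurable_fun setT (fun yx : X * X => M k yx.1 yx.2))
  (hMB : forall k, exists2 s : R, s < B & forall x y, `|M k y x| <= s)
  (hfm : forall k, measurable_fun setT (fun th => f k th theta0))
  (hlip : log_lipschitz p M f)
  (pi : probability Theta R) (F : set (probability Theta R))
  (rho : nat -> probability Theta R) (hF : forall n, F (rho n))
  (C : R) (hC : 0 < C)
  (h2d : forall k n, (0 < n)%N ->
     (\int[rho n]_th ((`|f k th theta0| `^ (2 + delta))%:E) <= (C / n%:R)%:E)%E)
  (h1 : forall k n, (0 < n)%N ->
     (\int[rho n]_th (`|f k th theta0|%:E) <= (C / Num.sqrt n%:R)%:E)%E)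
  (hKL : forall n, (0 < n)%N -> (KL (rho n) pi <= (C * Num.sqrt n%:R)%:E)%E) :
  exists eps : nat -> R,
    (exists K : R, forall n, (0 < n)%N ->
        eps n <= K * Num.max (1 / Num.sqrt n%:R) (n%:R `^ (delta / 2) / n%:R)) /\
    forall n, (0 < n)%N ->
      [/\ (\int[rho n]_th KL_path P q0 p Xs n theta0 th <= (n%:R * eps n)%:E)%E,
          (\int[rho n]_th 'V_P[r_n q0 p Xs n th theta0] <= (n%:R * eps n)%:E)%E &
          (KL (rho n) pi <= (n%:R * eps n)%:E)%E].
Proof.
(* Tonelli asks for sigma-finiteness as a structure on the measure, so the hypotheses are
   transported to a copy of [mu] that carries it. *)
pose smu : {sigma_finite_measure set X -> \bar R} :=
  sigma_finite_copy hmu.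
have hq0' : is_prob_density smu q0 by exact: hq0.
have hp' th : is_transition_density smu (p th) by exact: hp.
have hchain' : markov_chain_law smu q0 (p theta0) P Xs.
  have pE As x : pathint smu (p theta0) As x = pathint mu (p theta0) As x.
    by elim: As x => [//|A As IH] x /=; apply: eq_integral => y _; rewrite IH.
  have [mXs hlaw] := hchain; split => // A0 As mA0 mAs; rewrite hlaw//.
  by apply: eq_integral => x _; rewrite pE.
have [mXs _] := hchain.
have r01 : 0 < delta / (2 + delta) <= 1.
  have d2 : 0 < 2 + delta by rewrite addr_gt0.
  by rewrite divr_gt0//= ler_pdivrMr// mul1r lerDr.
have [L hL] := alpha_mix_summable mXs r01 hmix.
pose S := 2 + L; have hS := sum_step_corr_le hL.
have S0 : 0 <= S by apply: le_trans (hS 0%N); rewrite big_ord0.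
(* The absolute value of [B] is taken because for [m = 0] nothing fixes the sign of [B]. *)
pose c th := `|B| * \sum_(k < m) `|f k th theta0|.
have c0 th : 0 <= c th by rewrite mulr_ge0// sumr_ge0.
have hz th x y : (p theta0 y x = 0 /\ p th y x = 0) \/
    [/\ 0 < p theta0 y x, 0 < p th y x & `|ln (p theta0 y x) - ln (p th y x)| <= c th].
  case: (hlip theta0 th x y) => [|[? ? h]]; [by left|right; split => //].
  apply: le_trans h _; rewrite /c mulr_sumr; apply: ler_sum => k _.
  apply: ler_wpM2r => //; have [s sB hs] := hMB k.
  rewrite (le_trans (ler_norm _))// (le_trans (hs x y))// (le_trans (ltW sB))//.
  exact: ler_norm.
(* 16 is the 8 of the variance bound times the 2 of [sqr_sum_le], which also supplies [m]. [K1],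
   [K2] and [C] are the constants for the divergence, the variance and the prior, and [K] is their
   sum. *)
pose A := 16 * `|B| ^+ 2 * m%:R * S.
have A0 : 0 <= A by rewrite !mulr_ge0// exprn_ge0.
pose K1 := `|B| * (m%:R * C); pose K2 := A * (m%:R * (2 * C)).
have K10 : 0 <= K1 by rewrite !mulr_ge0// ltW.
have K20 : 0 <= K2 by rewrite !mulr_ge0// ltW.
pose K := K1 + K2 + C.
have K0 : 0 <= K by rewrite !addr_ge0// ltW.
exists (fun n => K / Num.sqrt n%:R); split.
  by exists K => n n0; rewrite ler_wpM2l// le_max div1r lexx.
move=> n n0; have n0R : 0 < n%:R :> R by rewrite ltr0n.
have s0 : 0 < Num.sqrt n%:R :> R by rewrite sqrtr_gt0.
have ss : Num.sqrt n%:R * Num.sqrt n%:R = n%:R :> R by rewrite -expr2 sqr_sqrtr// ltW.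
have mf k : measurable_fun setT (fun th => `|f k th theta0|) by exact: measurableT_comp.
have bound u : u <= K -> n%:R * (u / Num.sqrt n%:R) <= n%:R * (K / Num.sqrt n%:R).
  by move=> uK; rewrite ler_pM2l// ler_pM2r// invr_gt0.
split.
- apply: (@le_trans _ _ (\int[rho n]_th (n%:R * `|B| * \sum_(k < m) `|f k th theta0|)%:E)%E).
    apply: integral_le_ge0 => th.
      rewrite -mulrA; exact: (KL_path_le hq0' hp' P Xs (hz th) (c0 th) n).
    by rewrite lee_fin !mulr_ge0// sumr_ge0.
  apply: le_trans (integral_scaled_sum_le (t := C / Num.sqrt n%:R) _ mf _ _) _ => //.
    by move=> k; exact: h1.
  rewrite lee_fin (_ : _ * _ * _ = n%:R * (K1 / Num.sqrt n%:R)); last by rewrite /K1; ring.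
  by apply: bound; rewrite /K -addrA lerDl addr_ge0// ltW.
- pose g k th := `|f k th theta0| + `|f k th theta0| `^ (2 + delta).
  have g0 k th : 0 <= g k th by rewrite addr_ge0// powR_ge0.
  have mfp k : measurable_fun setT (fun th => `|f k th theta0| `^ (2 + delta)).
    exact: (measurableT_comp (measurable_powR _) (mf k)).
  have mg k : measurable_fun setT (g k) by exact: measurable_funD.
  apply: (@le_trans _ _ (\int[rho n]_th (n%:R * A * \sum_(k < m) g k th)%:E)%E).
    apply: integral_le_ge0 => th; last by rewrite lee_fin !mulr_ge0// sumr_ge0.
    apply: le_trans (variance_log_ratio_le hq0' hp' hchain' (hz th) (c0 th) n hS) _.
    rewrite lee_fin -(mulrA _ A) ler_pM2l//.
    rewrite (_ : A * _ = 8 * (`|B| ^+ 2 * (2 * m%:R * \sum_(k < m) g k th)) * S); last first.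
      by rewrite /A; ring.
    rewrite ler_wpM2r// ler_pM2l// /c exprMn ler_wpM2l ?exprn_ge0//.
    apply: le_trans (sqr_sum_le _) _; rewrite ler_wpM2l ?mulr_ge0//.
    by apply: ler_sum => k _; exact: sqr_le_norm_powR.
  apply: le_trans (integral_scaled_sum_le (t := 2 * C / Num.sqrt n%:R) _ mg _ _) _ => //.
    by rewrite mulr_ge0.
  move=> k; under eq_integral do rewrite EFinD.
    rewrite ge0_integralD//; last 2 first.
    + exact/measurable_EFinP.
    + exact/measurable_EFinP.
    apply: le_trans (leeD (h1 k n n0) (h2d k n n0)) _.
    (* The two moments add up to at most [2 * C / sqrt n], since [C / n <= C / sqrt n] for
       [n >= 1]. *)
    rewrite -EFinD lee_fin mulr_natl mulr2n mulrDl lerD2l ler_pM2l// lef_pV2 ?posrE//.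
    rewrite -[leRHS]ss ler_pMl// -[leLHS]sqrtr1 ler_wsqrtr// ler1n.
    exact: n0.
  rewrite lee_fin (_ : _ * _ * _ = n%:R * (K2 / Num.sqrt n%:R)); last by rewrite /K2; ring.
  by apply: bound; rewrite /K addrAC lerDr addr_ge0// ltW.
- apply: le_trans (hKL n n0) _; rewrite lee_fin.
  rewrite (_ : C * _ = n%:R * (C / Num.sqrt n%:R)); last first.
    apply: (mulIf (lt0r_neq0 s0)).
    by rewrite -(mulrA C) ss -(mulrA n%:R) divfK ?lt0r_neq0// mulrC.
  by apply: bound; rewrite /K lerDr addr_ge0.
Qed.
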